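(* Fix positive integers $\beta,p$. There is an algorithm which, given $n$ and a vector $\mathbf{c}\in\mathcal{S}_n(\beta,p)$, outputs $ord(\mathbf{c})$, the order of $\mathbf{c}$ in $\mathcal{S}_n(\beta,p)$; its time complexity and space complexity are both $O(n)$.
   Context: A binary vector is $(\beta,p)$-window-weight-limited (WWL) if every $\beta$ consecutive entries contain at most $p$ ones; $\mathcal{S}_n(\beta,p)$ is the set of $(\beta,p)$-WWL vectors of length $n$. For $\mathbf{x}=(x_1,\ldots,x_n)\in\{0,1\}^n$ let $\psi(\mathbf{x})=\sum_{k=1}^n x_k2^{n-k}$ (so $x_1$ is the most significant bit), and write $\mathbf{x}\preceq\mathbf{y}$ iff $\psi(\mathbf{x})\le\psi(\mathbf{y})$. For a set $X$ of distinct binary vectors of length $n$ and $\mathbf{x}\in X$, $ord(\mathbf{x})=|\{\mathbf{y}\in X:\mathbf{y}\preceq\mathbf{x}\}|$; thus $ord$ is a bijection from $\mathcal{S}_n(\beta,p)$ to $\{1,\ldots,|\mathcal{S}_n(\beta,p)|\}$. Complexity is measured with $\beta,p$ fixed, counting arithmetic operations and storage of integers at unit cost. *)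

(* Defs.v *)
From mathcomp Require Import all_boot.
Set Implicit Arguments. Unset Strict Implicit. Unset Printing Implicit Defensive.

Definition window_weight (beta n : nat) (x : n.-tuple bool) (i : nat) : nat :=
  \sum_(i <= k < i + beta) nth false x k.

Definition wwl (beta p n : nat) (x : n.-tuple bool) : bool :=
  [forall i : 'I_n.+1, (i + beta <= n) ==> (window_weight beta x i <= p)].

(* psi(x) = sum_k x_k 2^(n-k), x_1 (index 0 here) the most significant bit. *)
Definition psi (n : nat) (x : n.-tuple bool) : nat :=
  \sum_(k < n) nat_of_bool (tnth x k) * 2 ^ (n.-1 - k).

Definition ord (beta p n : nat) (x : n.-tuple bool) : nat :=
  #|[set y : n.-tuple bool | wwl beta p y && (psi y <= psi x)]|.

(* Memory: cells indexed by nat, each storing an unbounded natural number;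
   every arithmetic operation and every memory access costs one step. *)

Inductive instr : Type :=
| IConst (d k : nat)
| IAdd (d a b : nat)
| ISub (d a b : nat)
| IMul (d a b : nat)
| IDiv (d a b : nat)
| IMod (d a b : nat)
| ILoad (d a : nat)
| IStore (a s : nat)
| IJz (a t : nat)
| IJmp (t : nat)
| IHalt.

Definition memory := nat -> nat.

Definition upd (m : memory) (a v : nat) : memory := fun x => if x == a then v else m x.

(* One step: None if the machine has halted (current instruction is IHalt or
   the program counter is out of range); otherwise the new configuration and
   the list of memory addresses accessed by this step. *)
Definition step (P : seq instr) (pc : nat) (m : memory)
  : option ((nat * memory) * seq nat) :=
  match nth IHalt P pc with
  | IConst d k => Some (pc.+1, upd m d k, [:: d])
  | IAdd d a b => Some (pc.+1, upd m d (m a + m b), [:: d; a; b])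
  | ISub d a b => Some (pc.+1, upd m d (m a - m b), [:: d; a; b])
  | IMul d a b => Some (pc.+1, upd m d (m a * m b), [:: d; a; b])
  | IDiv d a b => Some (pc.+1, upd m d (m a %/ m b), [:: d; a; b])
  | IMod d a b => Some (pc.+1, upd m d (m a %% m b), [:: d; a; b])
  | ILoad d a => Some (pc.+1, upd m d (m (m a)), [:: d; a; m a])
  | IStore a s => Some (pc.+1, upd m (m a) (m s), [:: a; s; m a])
  | IJz a t => Some ((if m a == 0 then t else pc.+1), m, [:: a])
  | IJmp t => Some (t, m, [::])
  | IHalt => None
  end.

(* run P t pc m = Some (steps, final memory, space) if the machine halts within
   t steps; steps = number of steps executed, space = 1 + the largest memory
   address accessed during the run (0 if none). None if it has not halted
   after t steps. *)
Fixpoint run (P : seq instr) (t : nat) (pc : nat) (m : memory)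
  : option (nat * memory * nat) :=
  match step P pc m with
  | None => Some (0, m, 0)
  | Some (pc', m', addrs) =>
      match t with
      | 0 => None
      | t'.+1 =>
          match run P t' pc' m' with
          | None => None
          | Some (s, mf, sp) =>
              Some (s.+1, mf, maxn sp (foldr maxn 0 (map S addrs)))
          end
      end
  end.

Definition init_mem (n : nat) (c : n.-tuple bool) : memory :=
  fun x => if x == 0 then n
           else if x <= n then nat_of_bool (nth false c x.-1) else 0.

(* Main.v *)
Require Import Defs.
From mathcomp Require Import all_boot zify.
Set Implicit Arguments. Unset Strict Implicit. Unset Printing Implicit Defensive.

(* The rank of c counts the admissible words that are lexicographically at most
   c.  Admissibility is recognised by a finite automaton remembering the last
   beta bits, so the number of words of length k that reach a given state and
   are still smaller than (or equal to) the prefix of c of length k evolves by a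
   linear recursion whose coefficients depend only on the next bit of c.  A RAM
   evaluates such a recursion with constantly many registers and one loop over
   the input; as the input occupies the low cells, these are first folded into a
   single integer. *)

(** * Binary expansions *)

Lemma binary_recr (g : nat -> nat) r :
  \sum_(k < r.+1) g k * 2 ^ (r - k) = 2 * (\sum_(k < r) g k * 2 ^ (r.-1 - k)) + g r.
Proof.
rewrite big_ord_recr /= subnn muln1 big_distrr /=; congr addn.
apply: eq_bigr => k _.
have -> : r - k = (r.-1 - k).+1 by have := ltn_ord k; lia.
by rewrite expnS mulnCA.
Qed.

Lemma binary_lt (g : nat -> bool) r : \sum_(k < r) g k * 2 ^ (r.-1 - k) < 2 ^ r.
Proof.
elim: r => [|r IH]; first by rewrite big_ord0.
rewrite (binary_recr g) expnS; move: IH; case: (g r) => /=; lia.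
Qed.

(** * Weighted automata over the natural numbers *)

Definition wa_step (I : finType) (A : bool -> I -> I -> nat) (V : I -> nat) (b : bool) : I -> nat :=
  fun i => \sum_j A b i j * V j.

(** [A b] is the transition matrix of the letter [b], with [A b i j] the weight of going from [j] to
    [i]; [u] is the initial vector and [w] the final one. *)
Definition wa_value (I : finType) (A : bool -> I -> I -> nat) (u w : I -> nat) (s : seq bool) :=
  \sum_i w i * foldl (wa_step A) u s i.

(** * Straight-line code: its effect on memory and the addresses it accesses *)

Definition effect (i : instr) (m : memory) : memory :=
  if step [:: i] 0 m is Some ((_, m'), _) then m' else m.

Definition touched (i : instr) (m : memory) : seq nat :=
  if step [:: i] 0 m is Some (_, addrs) then addrs else [::].

Definition straight (i : instr) : bool :=
  match i with IJz _ _ | IJmp _ | IHalt => false | _ => true end.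

Definition effects (code : seq instr) (m : memory) : memory :=
  foldl (fun m i => effect i m) m code.

Lemma effects_cat c1 c2 m : effects (c1 ++ c2) m = effects c2 (effects c1 m).
Proof. exact: foldl_cat. Qed.

Definition target (i : instr) : nat :=
  match i with
  | IConst d _ | IAdd d _ _ | ISub d _ _ | IMul d _ _ | IDiv d _ _ | IMod d _ _
  | ILoad d _ => d
  | _ => 0
  end.

Definition storeless (i : instr) : bool := if i is IStore _ _ then false else true.

Lemma effects_frame code m x :
  all storeless code -> x \notin map target code -> effects code m x = m x.
Proof.
elim: code m => //= i code IH m /andP[si scode]; rewrite inE negb_or => /andP[xi xcode].
rewrite /effects /= -/(effects code _) IH //.
case: i si xi => [d k|d a b|d a b|d a b|d a b|d a b|d a|a s|a t|t|] //= _ xi;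
  by rewrite /effect /= /upd (negbTE xi).
Qed.

(** Depends on the memory because indirect loads and stores access addresses that are themselves
    computed. *)
Fixpoint safe (B : nat) (code : seq instr) (m : memory) : bool :=
  if code is i :: code' then
    [&& straight i, all (fun x => x < B) (touched i m) & safe B code' (effect i m)]
  else true.

Lemma safe_cat B c1 c2 m : safe B (c1 ++ c2) m = safe B c1 m && safe B c2 (effects c1 m).
Proof. by elim: c1 m => //= i c IH m; rewrite IH !andbA. Qed.

(** Without indirect accesses all addresses are literals, so they can be read off with any memory,
    here the zero one. *)
Definition direct (B : nat) (i : instr) : bool :=
  match i with
  | ILoad _ _ | IStore _ _ => false
  | _ => straight i && all (fun x => x < B) (touched i (fun=> 0))
  end.

Lemma safe_direct B B' code m : all (direct B) code -> B <= B' -> safe B' code m.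
Proof.
move=> + leB; elim: code m => //= i code IH m /andP[Hi /IH ->]; rewrite andbT.
by case: i Hi => //=; rewrite ?andbT; lia.
Qed.

(** * Executions with an address bound, and the counting loop *)

Inductive exec (P : seq instr) (B : nat) : nat -> nat -> memory -> nat -> memory -> Prop :=
| ExecNil pc m : exec P B 0 pc m pc m
| ExecStep t pc m pc1 m1 addrs pc' m' :
    step P pc m = Some ((pc1, m1), addrs) -> all (fun x => x < B) addrs ->
    exec P B t pc1 m1 pc' m' -> exec P B t.+1 pc m pc' m'.

Lemma exec_trans P B t1 t2 pc m pc1 m1 pc2 m2 :
  exec P B t1 pc m pc1 m1 -> exec P B t2 pc1 m1 pc2 m2 ->
  exec P B (t1 + t2) pc m pc2 m2.
Proof.
by move=> e1 e2; elim: e1 e2 => // *; rewrite addSn; apply: ExecStep; eauto.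
Qed.

(** Space is one plus the largest address, so addresses below [B] give space at most [B]; surplus
    fuel is harmless once [IHalt] is reached. *)
Lemma exec_run P B t pc m pc' m' T :
  exec P B t pc m pc' m' -> nth IHalt P pc' = IHalt -> t <= T ->
  exists2 sp, run P T pc m = Some (t, m', sp) & sp <= B.
Proof.
move=> e halt; elim: e T halt => {t pc m pc' m'} [pc m|t pc m pc1 m1 addrs pc' m' Hs Ha _ IH] T halt leT.
  by exists 0 => //; case: T leT => [|T] _ /=; rewrite /step halt.
case: T leT => // T leT; have [sp Hr leB] := IH T halt leT.
exists (maxn sp (foldr maxn 0 (map S addrs))); first by rewrite /= Hs Hr.
rewrite geq_max leB /=; elim: addrs Ha {Hs} => //= x addrs IHa /andP[ltx /IHa].
by rewrite geq_max ltx.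
Qed.

Definition code_at (P : seq instr) (pc : nat) (code : seq instr) : Prop :=
  forall k, k < size code -> nth IHalt P (pc + k) = nth IHalt code k.

Lemma code_at_cat pre code post : code_at (pre ++ code ++ post) (size pre) code.
Proof.
by move=> k ltk; rewrite nth_cat ifN ?addKn; [rewrite nth_cat ltk | lia].
Qed.

Lemma exec_block P B pc code m : code_at P pc code -> safe B code m ->
  exec P B (size code) pc m (pc + size code) (effects code m).
Proof.
elim: code pc m => [|i code IH] pc m Hat /=; first by rewrite addn0 => _; constructor.
case/and3P=> si ti sc; rewrite addnS -addSn.
apply: (ExecStep (pc1 := pc.+1) (m1 := effect i m) (addrs := touched i m)) => //.
  have := Hat 0 isT; rewrite addn0 /= /step => ->.
  by case: (i) si.
by apply: IH => // k ltk; rewrite addSnnS (Hat k.+1).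
Qed.

(** Register [r] holds the number of rounds left. A round costs the body plus the test and the back
    jump; the last, failing test adds one step. *)
Lemma exec_while P B pc r body n (Inv : nat -> memory -> Prop) m :
  code_at P pc (IJz r (pc + size body + 2) :: body ++ [:: IJmp pc]) ->
  r < B ->
  (forall j m, Inv j m -> m r = n - j) ->
  (forall j m, j < n -> Inv j m -> safe B body m /\ Inv j.+1 (effects body m)) ->
  Inv 0 m ->
  exists2 m', exec P B (n * (size body + 2) + 1) pc m (pc + size body + 2) m' & Inv n m'.
Proof.
move=> Hat ltr HR Hbody I0.
have jz := Hat 0 isT; rewrite addn0 /= in jz.
have body_at : code_at P pc.+1 body.
  move=> k ltk; rewrite addSnnS Hat /= ?nth_cat ?ltk // size_cat /=; lia.
have jmp : nth IHalt P (pc.+1 + size body) = IJmp pc.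
  by rewrite addSnnS Hat /= ?nth_cat ?ltnn ?subnn // size_cat /=; lia.
have loop k : k <= n -> exists2 m', exec P B (k * (size body + 2)) pc m pc m' & Inv k m'.
  elim: k => [_|k IH ltk]; first by exists m => //; constructor.
  have [m1 e1 I1] := IH (ltnW ltk); have [sb I2] := Hbody _ _ ltk I1.
  exists (effects body m1) => //; rewrite mulSn addnC; apply: exec_trans e1 _.
  rewrite addn2; apply: (ExecStep (pc1 := pc.+1) (m1 := m1) (addrs := [:: r])).
  - by rewrite /step jz (HR _ _ I1) ifN //; lia.
  - by rewrite /= ltr.
  rewrite -addn1; apply: exec_trans (exec_block body_at sb) _.
  apply: (ExecStep (pc1 := pc) (m1 := effects body m1) (addrs := [::])) => //; last by constructor.
  by rewrite /step jmp.
have [m1 e1 I1] := loop n (leqnn n); exists m1 => //.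
apply: exec_trans e1 _.
apply: (ExecStep (m1 := m1) (addrs := [:: r])); last by constructor.
  by rewrite /step jz (HR _ _ I1) subnn.
by rewrite /= ltr.
Qed.

(** * Clearing cells and accumulating products *)

Lemma all_flatten (T : Type) (a : pred T) ss : all a (flatten ss) = all (all a) ss.
Proof. by elim: ss => //= s ss IH; rewrite all_cat IH. Qed.

Definition zeros (ds : seq nat) : seq instr := [seq IConst d 0 | d <- ds].

Lemma zerosE ds m x : effects (zeros ds) m x = if x \in ds then 0 else m x.
Proof.
elim: ds m => //= d ds IH m; rewrite /= in IH *.
rewrite /zeros /= -/(zeros ds) IH inE /effect /= /upd.
by case: (x == d); case: (x \in ds).
Qed.

(* [Mac d k x y] stands for M[d] := M[d] + k * M[x] * M[y], with cell 6 as scratch. *)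
Record mac := Mac { mac_dst : nat; mac_coef : nat; mac_x : nat; mac_y : nat }.

Definition mac_code (e : mac) : seq instr :=
  [:: IConst 6 (mac_coef e); IMul 6 6 (mac_x e); IMul 6 6 (mac_y e);
      IAdd (mac_dst e) (mac_dst e) 6].

Definition macs (es : seq mac) : seq instr := flatten (map mac_code es).

(** No source cell is a destination or the scratch cell, so every product reads the initial values
    and the updates simply add up. *)
Lemma macsE (src : pred nat) es m x : ~~ src 6 ->
  all (fun e => [&& src (mac_x e), src (mac_y e), ~~ src (mac_dst e) & mac_dst e != 6]) es ->
  x != 6 ->
  effects (macs es) m x =
  m x + \sum_(e <- es | mac_dst e == x) mac_coef e * m (mac_x e) * m (mac_y e).
Proof.
move=> src6 wf x6.
(* The sources keep their values [m0] while the rest of the memory changes along the induction. *)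
suff gen m0 : (forall y, src y -> m y = m0 y) -> effects (macs es) m x =
    m x + \sum_(e <- es | mac_dst e == x) mac_coef e * m0 (mac_x e) * m0 (mac_y e) by exact: gen.
elim: es wf m => [|e es IH] wf m mE; first by rewrite big_nil addn0.
case/andP: wf => /and4P[sx sy sd d6] wf.
have neq6 y : src y -> (y == 6) = false by move=> sy'; apply: contraNF src6 => /eqP <-.
have neqd y : src y -> (y == mac_dst e) = false by move=> sy'; apply: contraNF sd => /eqP <-.
have eff y : effects (mac_code e) m y =
    if y == mac_dst e then m y + mac_coef e * m0 (mac_x e) * m0 (mac_y e)
    else if y == 6 then mac_coef e * m0 (mac_x e) * m0 (mac_y e) else m y.
  rewrite /effects /effect /= /upd /= (neq6 _ sx) (neq6 _ sy) (negbTE d6) (mE _ sx) (mE _ sy).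
  case: (eqVneq y (mac_dst e)) => [->|] //; by case: (y == 6).
have -> : macs (e :: es) = mac_code e ++ macs es by [].
rewrite effects_cat big_cons IH // => [|y sy']; last by rewrite eff neqd ?neq6 ?mE.
by rewrite eff (negbTE x6) eq_sym; case: ifP => // _; rewrite addnA.
Qed.

(** * A program evaluating a weighted automaton *)

Section WeightedAutomatonProgram.
Variables (I : finType) (A : bool -> I -> I -> nat) (u w : I -> nat).

Definition nstates : nat := #|I|.
(** Cells 0 to 8 are fixed registers; the current vector occupies a block from 9 on, and the next
    vector the block behind it, ending just below [regs]. *)
Definition cell (i : I) : nat := (enum_rank i).+4.+4.+1.
Definition cell' (i : I) : nat := (nstates + enum_rank i).+4.+4.+1.
Definition regs : nat := (nstates + nstates).+4.+4.+1.
Definition top : nat := 2 ^ regs.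
Definition top_bit : nat := 2 ^ regs.-1.
Arguments regs : simpl never.
Arguments top : simpl never.
Arguments top_bit : simpl never.

(* The input sits in cells 1..n, so there is no free register at the start.
   Horner's rule folds cells 1..regs into cell 0, which needs none. *)
Definition pack : seq instr :=
  flatten [seq [:: IAdd 0 0 0; IAdd 0 0 k] | k <- iota 1 regs].

(** After packing, cell 0 holds [n * top] plus a number below [top]: the quotient by [top] recovers
    the length, the remainder the leading bits. *)
Definition setup : seq instr :=
  pack ++ [:: IConst 6 top; IDiv 2 0 6; IMod 3 0 6; IConst 1 0; IConst 8 1]
       ++ zeros (map cell (enum I)) ++ macs [seq Mac (cell i) (u i) 8 8 | i <- enum I].

(* Cell 1 is the position, 2 the number of bits left, 4 and 5 the current bit
   and its complement, 6 and 7 scratch, 8 the constant 1.  Cell 3 is a shift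
   register holding the bits among the first [regs] that are not yet consumed;
   later bits are still in place, and the flag [regs < position] computed in
   cell 6 masks the value loaded from a cell that has become a register. *)
Definition fetch : seq instr :=
  [:: IAdd 1 1 8; ISub 2 2 8;
      IConst 6 regs.+1; IDiv 6 1 6; ISub 6 8 6; ISub 6 8 6].
Definition fetch' : seq instr :=
  [:: IMul 4 4 6; IConst 6 top_bit; IDiv 7 3 6; IAdd 4 4 7;
      IAdd 3 3 3; IConst 6 top; IMod 3 3 6; ISub 5 8 4].

(** Branch-free choice of the matrix: cells 5 and 4 hold [1 - b] and [b], so one of the two products
    vanishes. *)
Definition transition : seq mac :=
  flatten [seq [:: Mac (cell' i) (A false i j) 5 (cell j); Mac (cell' i) (A true i j) 4 (cell j)]
          | i <- enum I, j <- enum I].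

(** Every new entry may need every old one, so the new vector is built in the second block and then
    copied back. *)
Definition transit : seq instr :=
  zeros (map cell' (enum I)) ++ macs transition ++
  zeros (map cell (enum I)) ++ macs [seq Mac (cell i) 1 8 (cell' i) | i <- enum I].

Definition loop_body : seq instr := fetch ++ ILoad 4 1 :: fetch' ++ transit.

Definition output : seq instr :=
  IConst 0 0 :: macs [seq Mac 0 (w i) 8 (cell i) | i <- enum I].

Definition program : seq instr :=
  setup ++ (IJz 2 (size setup + size loop_body + 2) :: loop_body ++ [:: IJmp (size setup)])
        ++ output.

(** * Effect of packing, fetching, transition and output *)

Lemma packE r m x :
  effects (flatten [seq [:: IAdd 0 0 0; IAdd 0 0 k] | k <- iota 1 r]) m x =
  if x == 0 then m 0 * 2 ^ r + \sum_(k < r) m k.+1 * 2 ^ (r.-1 - k) else m x.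
Proof.
elim: r x => [|r IH] x; first by rewrite /= big_ord0 muln1 addn0; case: eqP => [->|].
have -> : iota 1 r.+1 = iota 1 r ++ [:: r.+1] by rewrite -{1}[r.+1]addn1 iotaD.
rewrite map_cat flatten_cat effects_cat; set m1 := effects (flatten _) m in IH *.
rewrite /effects /= /effect /= /upd /= !IH /= (binary_recr (fun k => m k.+1)).
case: (x == 0) => //.
by rewrite expnS mulnCA !mul2n -!addnn [RHS]addnA [in LHS]addnACA.
Qed.

Lemma fetchE (m : memory) j N v : m 1 = j -> m 2 = N -> m 3 = v -> m 8 = 1 ->
  let m' := effects (fetch ++ ILoad 4 1 :: fetch') m in
  let b := (if regs <= j then m j.+1 else 0) + v %/ top_bit in
  [/\ m' 1 = j.+1, m' 2 = N.-1, m' 3 = (2 * v) %% top, m' 4 = b & m' 5 = 1 - b]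
  /\ (forall x, 8 <= x -> m' x = m x).
Proof.
move=> m1 m2 m3 m8 m' b.
rewrite {}/m' -cat1s !effects_cat.
set mf := effects fetch m; set ml := effects [:: ILoad 4 1] mf.
have mf_out x : 8 <= x -> mf x = m x.
  by move=> lex; rewrite /mf effects_frame //= !inE; lia.
have mf1 : mf 1 = j.+1 by rewrite /mf /effects /= /effect /= /upd /= m1 m8 addn1.
have mf2 : mf 2 = N.-1 by rewrite /mf /effects /= /effect /= /upd /= m2 m8 subn1.
have mf3 : mf 3 = v by [].
(* The quotient of [j.+1] by [regs.+1] is positive exactly when [regs <= j]; two truncated
   subtractions from 1 turn it into 0 or 1. *)
have mf6 : mf 6 = (regs <= j).
  rewrite /mf /effects /= /effect /= /upd /= m1 m8 addn1.
  case: (leqP regs j) => le_j; last by rewrite divn_small.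
  have: 0 < j.+1 %/ regs.+1 by rewrite divn_gt0.
  by case: (_ %/ _) => // q _; lia.
have ml_out x : x != 4 -> ml x = mf x.
  by move=> x4; rewrite /ml effects_frame //= inE.
have ml4 : ml 4 * ml 6 = if regs <= j then m j.+1 else 0.
  rewrite (ml_out 6) // mf6 /ml /effects /= /effect /= /upd /= mf1.
  case: (leqP regs j) => le_j; last by rewrite /= muln0.
  by rewrite /= muln1 mf_out //; rewrite /regs in le_j; lia.
rewrite -[fetch']/(take 7 fetch' ++ [:: ISub 5 8 4]) effects_cat.
set mb := effects (take 7 fetch') ml.
have mb3 : mb 3 = (2 * v) %% top.
  by rewrite /mb /effects /= /effect /= /upd /= (ml_out 3) ?mf3 ?addnn ?mul2n.
have mb4 : mb 4 = b.
  by rewrite /mb /effects /= /effect /= /upd /= ml4 (ml_out 3) ?mf3.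
have mb_out x : (x < 3) || (8 <= x) -> mb x = mf x.
  move=> xout; rewrite /mb effects_frame //= ?inE; last by lia.
  by rewrite ml_out //; lia.
have m'E x : effects [:: ISub 5 8 4] mb x = if x == 5 then 1 - b else mb x.
  by rewrite /effects /= /effect /= /upd mb4 mb_out // mf_out // m8.
split; last first.
  by move=> x lex; rewrite m'E ifN ?mb_out ?mf_out //; lia.
by split; rewrite m'E //= mb_out.
Qed.

Lemma rank_lt (i : I) : enum_rank i < nstates.
Proof. exact: ltn_ord. Qed.

Lemma cell_lt i : 8 < cell i < nstates + 9.
Proof. by rewrite /cell; have := rank_lt i; lia. Qed.

Lemma cell'_lt i : nstates + 9 <= cell' i < regs.
Proof. by rewrite /cell' /regs; have := rank_lt i; lia. Qed.

Lemma cell_inj : injective cell.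
Proof. by move=> i j [] /ord_inj/enum_rank_inj. Qed.

Lemma cell'_inj : injective cell'.
Proof. by move=> i j [] /addnI/ord_inj/enum_rank_inj. Qed.

Lemma mem_cells i : (cell i \in map cell (enum I)).
Proof. by rewrite map_f ?mem_enum. Qed.

Lemma mem_cells' i : (cell' i \in map cell' (enum I)).
Proof. by rewrite map_f ?mem_enum. Qed.

Lemma notin_cells x : (x < 9) || (nstates + 9 <= x) -> (x \in map cell (enum I)) = false.
Proof. by move=> ltx; apply/mapP => -[i _ E]; have := cell_lt i; rewrite -E; lia. Qed.

Lemma notin_cells' x : (x < nstates + 9) || (regs <= x) -> (x \in map cell' (enum I)) = false.
Proof. by move=> ltx; apply/mapP => -[i _ E]; have := cell'_lt i; rewrite -E; lia. Qed.

Lemma sum_dst (E : eqType) (d : I -> E) (F : I -> nat) i0 : injective d ->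
  \sum_(i <- enum I | d i == d i0) F i = F i0.
Proof.
move=> inj_d; rewrite big_enum_cond /=.
rewrite (eq_bigl (pred1 i0)) ?big_pred1_eq // => i /=.
by rewrite (inj_eq inj_d).
Qed.

Lemma transitE (m : memory) (V : I -> nat) (b : bool) :
  m 4 = b :> nat -> m 5 = 1 - b -> m 8 = 1 -> (forall i, m (cell i) = V i) ->
  let m' := effects transit m in
  (forall i, m' (cell i) = wa_step A V b i) /\
  (forall x, x != 6 -> (x < 9) || (regs <= x) -> m' x = m x).
Proof.
move=> m4 m5 m8 mV m'.
rewrite /m' /transit !effects_cat {m'}.
set m1 := effects (zeros (map cell' _)) m.
set m2 := effects (macs transition) m1.
set m3 := effects (zeros (map cell _)) m2.
have m1E x : m1 x = if x \in map cell' (enum I) then 0 else m x by exact: zerosE.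
have m2E x : x != 6 -> m2 x = m1 x + \sum_(e <- transition | mac_dst e == x)
    mac_coef e * m1 (mac_x e) * m1 (mac_y e).
  (* Sources are the fixed registers and the first block; destinations lie in the second block. *)
  apply: (macsE (src := fun y => (y != 6) && (y < nstates + 9))) => //.
  rewrite /transition all_flatten; apply/all_allpairsP => i j _ _ /=.
  have := cell_lt j; have := cell'_lt i; lia.
have m3E x : m3 x = if x \in map cell (enum I) then 0 else m2 x by exact: zerosE.
have m2_cell' i : m2 (cell' i) = wa_step A V b i.
  have := cell'_lt i => lt_i.
  rewrite m2E; last by lia.
  rewrite m1E mem_cells' add0n big_mkcond big_flatten big_allpairs_dep /= /wa_step.
  rewrite (eq_bigr (fun k => if cell' k == cell' i then \sum_j A b k j * V j else 0)).
    by rewrite -big_mkcond sum_dst //; exact: cell'_inj.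
  move=> k _; rewrite -[in RHS]big_enum /=; case: ifP => ki; last first.
    by rewrite big1 // => j _; rewrite !big_cons big_nil /= ki.
  apply: eq_bigr => j _; rewrite !big_cons big_nil /= ki.
  have := cell_lt j => lt_j.
  rewrite !m1E !notin_cells' //; try lia.
  by rewrite m4 m5 mV; case: (b); rewrite ?muln0 ?muln1 ?mul0n ?addn0.
have copyE x : x != 6 -> effects (macs [seq Mac (cell i) 1 8 (cell' i) | i <- enum I]) m3 x =
    m3 x + \sum_(i <- enum I | cell i == x) m2 8 * m2 (cell' i).
  move=> x6; rewrite (macsE (src := fun y => (y == 8) || (nstates + 9 <= y))) //.
    rewrite big_map /=; congr addn; apply: eq_bigr => i _; rewrite mul1n.
    have := cell'_lt i => lt_i.
    by rewrite !m3E !notin_cells //; lia.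
  by lia.
  rewrite all_map; apply/allP => i _ /=.
  have := cell_lt i; have := cell'_lt i; lia.
have m2_out x : x != 6 -> (x < 9) || (regs <= x) -> m2 x = m x.
  move=> x6 xout; rewrite m2E // m1E notin_cells'; last by lia.
  rewrite big_flatten big_allpairs_dep /= big1 ?addn0 // => i _.
  rewrite big1 // => j _; rewrite !big_cons big_nil /=.
  by rewrite !ifN //; have := cell'_lt i; lia.
split=> [i|x x6 xout]; first last.
  rewrite copyE // big_hasC; last first.
    by apply/hasPn => i _; have := cell_lt i; rewrite /regs in xout *; lia.
  by rewrite addn0 m3E notin_cells ?m2_out //; rewrite /regs in xout *; lia.
rewrite copyE; last by have := cell_lt i; lia.
by rewrite m3E mem_cells sum_dst ?(m2_out 8) ?m8 ?mul1n ?m2_cell' //; exact: cell_inj.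
Qed.

Lemma outputE m : m 8 = 1 -> effects output m 0 = \sum_i w i * m (cell i).
Proof.
move=> m8; rewrite /output -cat1s effects_cat.
set m1 := effects [:: IConst 0 0] m.
have m1E x : x != 0 -> m1 x = m x by move=> x0; rewrite /m1 effects_frame //= inE.
have m10 : m1 0 = 0 by [].
rewrite (macsE (src := fun y => 8 <= y)) //; last first.
  rewrite all_map; apply/allP => i _ /=.
  have := cell_lt i; lia.
rewrite big_map m10 add0n /= big_enum /=; apply: eq_bigr => i _.
by rewrite !m1E // m8 muln1.
Qed.

(** * The shift register and the loop invariant *)

Definition head_bit (s : seq bool) (k : nat) : bool := (k < regs) && nth false s k.

(** The digits [j] to [j + regs - 1] of the packed head, padded with zeros; the leading digit is the
    next bit to consume. *)
Definition shift_register (s : seq bool) (j : nat) : nat :=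
  \sum_(k < regs) head_bit s (j + k) * 2 ^ (regs.-1 - k).

Lemma shift_register_div s j : shift_register s j %/ top_bit = head_bit s j.
Proof.
rewrite /shift_register /top_bit; move: (head_bit s) => f.
case: regs (isT : 0 < regs) => // r _ /=.
rewrite big_ord_recl /= subn0 addn0 divnMDl ?expn_gt0 //.
rewrite divn_small ?addn0 //.
rewrite (eq_bigr (fun k : 'I_r => f (j + k.+1) * 2 ^ (r.-1 - k))); first exact: (binary_lt (fun k => f (j + k.+1))).
by move=> k _; congr (_ * 2 ^ _); rewrite /bump /=; lia.
Qed.

Lemma shift_register_mod s j : (2 * shift_register s j) %% top = shift_register s j.+1.
Proof.
rewrite /shift_register /top.
(* The digit entering from the right has index [j + regs], past the head, so doubling rightly shifts
   in a zero. *)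
have fr : head_bit s (j.+1 + regs.-1) = false.
  by apply/andP => -[]; lia.
move: fr; move: (head_bit s) => f.
case: regs (isT : 0 < regs) => // r _ /= fr.
rewrite (binary_recr (fun k => f (j.+1 + k))) fr addn0.
rewrite big_ord_recl /= subn0 addn0 mulnDr mulnCA -expnS modnMDl.
rewrite (eq_bigr (fun k : 'I_r => f (j.+1 + k) * 2 ^ (r.-1 - k))); last first.
  by move=> k _; congr (nat_of_bool (f _) * 2 ^ _); rewrite /bump /=; lia.
by rewrite modn_small // expnS ltn_pmul2l // (binary_lt (fun k => f (j.+1 + k))).
Qed.

Section Correctness.
Variables (n : nat) (c : n.-tuple bool).

Lemma init_memS k : init_mem c k.+1 = nth false c k.
Proof.
rewrite /init_mem /=; case: leqP => // le_n.
by rewrite nth_default // size_tuple.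
Qed.

(** The vector is that of the prefix read so far. Only cells above [regs] must still hold input,
    since the bits of cells 1 to [regs] were packed. *)
Definition loop_inv (j : nat) (m : memory) : Prop :=
  [/\ m 1 = j, m 2 = n - j, m 3 = shift_register c j & m 8 = 1] /\
  [/\ forall i, m (cell i) = foldl (wa_step A) u (take j c) i
    & forall x, regs < x -> m x = init_mem c x].

Lemma setup_inv : loop_inv 0 (effects setup (init_mem c)).
Proof.
rewrite /setup effects_cat; set mp := effects pack _; rewrite !effects_cat.
set ms := effects [:: _; _; _; _; _] _.
set mz := effects (zeros _) _.
have mpE x : mp x = if x == 0 then n * top + shift_register c 0 else init_mem c x.
  rewrite /mp packE; case: (x == 0) => //; congr addn.
  by apply: eq_bigr => k _; rewrite init_memS /head_bit add0n ltn_ord.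
have reg_lt : shift_register c 0 < top by exact: (binary_lt (fun k => head_bit c (0 + k))).
have ms1 : ms 1 = 0 by [].
have ms8 : ms 8 = 1 by [].
have ms2 : ms 2 = n.
  rewrite /ms /effects /= /effect /= /upd /= mpE /= divnMDl ?divn_small ?addn0 //.
  by rewrite /top expn_gt0.
have ms3 : ms 3 = shift_register c 0.
  by rewrite /ms /effects /= /effect /= /upd /= mpE /= modnMDl modn_small.
have ms_out x : 8 < x -> ms x = init_mem c x.
  by move=> ltx; rewrite /ms effects_frame //= ?inE ?mpE ?ifN //; lia.
have mzE x : mz x = if x \in map cell (enum I) then 0 else ms x by exact: zerosE.
have mE x : x != 6 -> effects (macs [seq Mac (cell i) (u i) 8 8 | i <- enum I]) mz x =
    mz x + \sum_(i <- enum I | cell i == x) u i.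
  move=> x6; rewrite (macsE (src := pred1 8)) //.
    rewrite big_map /=; congr addn; apply: eq_bigr => i _.
    by rewrite mzE notin_cells // ms8 !muln1.
  by rewrite all_map; apply/allP => i _ /=; have := cell_lt i; lia.
have m_out x : x != 6 -> (x < 9) || (regs <= x) ->
    effects (macs [seq Mac (cell i) (u i) 8 8 | i <- enum I]) mz x = ms x.
  move=> x6 xout; rewrite mE // big_hasC.
    by rewrite addn0 mzE notin_cells //; rewrite /regs in xout *; lia.
  by apply/hasPn => i _; have := cell_lt i; rewrite /regs in xout *; lia.
split; first by split; rewrite m_out // subn0.
split=> [i|x ltx]; last first.
  by rewrite m_out ?ms_out //; rewrite /regs in ltx *; lia.
rewrite mE; last by have := cell_lt i; lia.
by rewrite mzE mem_cells sum_dst ?take0 //; exact: cell_inj.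
Qed.

Lemma body_inv j m : j < n -> loop_inv j m -> loop_inv j.+1 (effects loop_body m).
Proof.
move=> ltj [[m1 m2 m3 m8] [mV m_out]].
rewrite /loop_body -cat_cons catA effects_cat.
have [] := fetchE m1 m2 m3 m8; set m' := effects (fetch ++ _) m.
rewrite shift_register_div => -[m'1 m'2 m'3 m'4 m'5] m'_out.
(* Exactly one of the two places supplies the bit, the other contributes 0. *)
have bitE : (if regs <= j then m j.+1 else 0) + head_bit c j = nth false c j.
  rewrite /head_bit; case: (leqP regs j) => le_j //.
  by rewrite m_out // init_memS addn0.
rewrite bitE in m'4 m'5; rewrite shift_register_mod in m'3.
have m'V i : m' (cell i) = foldl (wa_step A) u (take j c) i.
  by rewrite m'_out ?mV //; have := cell_lt i; lia.
have m'8 : m' 8 = 1 by rewrite m'_out.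
have [tV t_out] := transitE m'4 m'5 m'8 m'V.
split; first by split; rewrite t_out // m'2; lia.
split=> [i|x ltx].
  by rewrite tV (take_nth false) ?size_tuple // foldl_rcons.
by rewrite t_out ?m'_out ?m_out //; rewrite /regs in ltx *; lia.
Qed.

End Correctness.

(** * Address bounds, total cost and correctness of the program *)

Lemma direct_zeros B ds : all (fun d => d < B) ds -> all (direct B) (zeros ds).
Proof. by rewrite all_map => /sub_all; apply => d /= ->. Qed.

Lemma direct_macs B es : 6 < B ->
  all (fun e => [&& mac_dst e < B, mac_x e < B & mac_y e < B]) es -> all (direct B) (macs es).
Proof.
move=> lt6; rewrite all_flatten all_map => /sub_all; apply => e /and3P[ld lx ly] /=.
by rewrite ld lx ly lt6.
Qed.

Lemma direct_setup : all (direct regs.+1) setup.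
Proof.
rewrite /setup all_cat; apply/andP; split.
  by rewrite /pack all_flatten all_map; apply/allP => k; rewrite mem_iota /=; lia.
rewrite !all_cat; apply/and3P; split.
- by rewrite /= /regs; lia.
- by apply: direct_zeros; rewrite all_map; apply/allP => i _ /=; have := cell_lt i; rewrite /regs; lia.
apply: direct_macs; first by rewrite /regs; lia.
by rewrite all_map; apply/allP => i _ /=; have := cell_lt i; rewrite /regs; lia.
Qed.

Lemma direct_transit : all (direct regs.+1) transit.
Proof.
have lt6 : 6 < regs.+1 by rewrite /regs; lia.
rewrite /transit !all_cat; apply/and4P; split.
- by apply: direct_zeros; rewrite all_map; apply/allP => i _ /=; have := cell'_lt i; lia.
- apply: direct_macs => //; rewrite all_flatten; apply/all_allpairsP => i j _ _ /=.
  by have := cell'_lt i; have := cell_lt j; rewrite /regs; lia.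
- by apply: direct_zeros; rewrite all_map; apply/allP => i _ /=; have := cell_lt i; rewrite /regs; lia.
apply: direct_macs => //; rewrite all_map; apply/allP => i _ /=.
by have := cell'_lt i; have := cell_lt i; rewrite /regs; lia.
Qed.

Lemma direct_output : all (direct regs.+1) output.
Proof.
rewrite /output /=; apply: direct_macs; first by rewrite /regs; lia.
by rewrite all_map; apply/allP => i _ /=; have := cell_lt i; rewrite /regs; lia.
Qed.

(** The only indirect access is the load through cell 1, at address [j.+1], which is at most [n]. *)
Lemma safe_body j n m : m 1 = j -> m 8 = 1 -> j < n -> safe (regs + n).+1 loop_body m.
Proof.
move=> m1 m8 ltj; rewrite /loop_body safe_cat.
have leB : regs.+1 <= (regs + n).+1 by lia.
apply/andP; split.
  by apply: safe_direct leB; rewrite /= /regs; lia.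
have mf1 : effects fetch m 1 = j.+1.
  by rewrite /effects /= /effect /= /upd /= m1 m8 addn1.
rewrite -cat1s safe_cat; set mf := effects fetch m in mf1 *.
apply/andP; split; first by rewrite /= mf1 /regs; lia.
rewrite safe_cat; apply/andP; split.
  by apply: safe_direct leB; rewrite /= /regs; lia.
exact: safe_direct direct_transit leB.
Qed.

Lemma program_correct n (c : n.-tuple bool) :
  exists2 m', exec program (regs + n).+1
     (size setup + (n * (size loop_body + 2) + 1) + size output)
     0 (init_mem c) (size program) m' & m' 0 = wa_value A u w c.
Proof.
have leB : regs.+1 <= (regs + n).+1 by lia.
have setup_at : code_at program 0 setup by exact: (@code_at_cat [::]).
pose loop := IJz 2 (size setup + size loop_body + 2) :: loop_body ++ [:: IJmp (size setup)].
have loop_at : code_at program (size setup) loop by exact: code_at_cat.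
have size_loop : size setup + size loop = size setup + size loop_body + 2.
  by rewrite /loop; move: (loop_body) (setup) => body pre; rewrite /= size_cat /=; lia.
have output_at : code_at program (size setup + size loop_body + 2) output.
  rewrite -size_loop -size_cat /program -/loop.
  by have := @code_at_cat (setup ++ loop) output [::]; rewrite cats0 -catA.
have e1 := exec_block setup_at (safe_direct (init_mem c) direct_setup leB).
have [|j m [[_ m2 _ _] _]||m2 e2 [[_ _ _ m28] [m2V _]]] :=
  exec_while (n := n) (Inv := loop_inv c) loop_at (_ : 2 < (regs + n).+1) _ _ (setup_inv c).
- by rewrite /regs; lia.
- by [].
- move=> j m ltj Ij; split; last exact: body_inv.
  by case: Ij => -[m1 _ _ m8] _; exact: safe_body m1 m8 ltj.
have e3 := exec_block output_at (safe_direct m2 direct_output leB).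
exists (effects output m2); last first.
  rewrite outputE // /wa_value; apply: eq_bigr => i _.
  by rewrite m2V take_oversize // size_tuple.
have -> : size program = size setup + size loop_body + 2 + size output.
  by rewrite -size_loop /program -/loop !size_cat addnA.
exact: exec_trans (exec_trans e1 e2) e3.
Qed.

End WeightedAutomatonProgram.

Lemma ram_wa_value (I : finType) (A : bool -> I -> I -> nat) (u w : I -> nat) :
  exists (P : seq instr) (K : nat), forall n (c : n.-tuple bool),
    exists (steps : nat) (mf : memory) (space : nat),
        run P (K * n.+1) 0 (init_mem c) = Some (steps, mf, space) /\
        steps <= K * n.+1 /\ space <= K * n.+1 /\ mf 0 = wa_value A u w c.
Proof.
pose a := size (setup u); pose b := size (loop_body A) + 2; pose o := size (output w).
(* The size terms bound the time and [(regs I).+1] the space; none of them depends on [n]. *)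
exists (program A u w), (a + b + 1 + o + (regs I).+1) => n c.
have [m' e m'0] := program_correct A u w c; rewrite -/a -/b -/o in e.
have le_t : a + (n * b + 1) + o <= (a + b + 1 + o + (regs I).+1) * n.+1 by nia.
(* The run falls off the end of the program, where the default instruction is [IHalt]. *)
have [|sp r le_sp] := exec_run e _ le_t; first by rewrite nth_default.
exists (a + (n * b + 1) + o), m', sp; do !split=> //.
by apply: leq_trans le_sp _; nia.
Qed.

(** * Ranking words as a weighted automaton *)

Fixpoint wa_costate (I : finType) (A : bool -> I -> I -> nat) (w : I -> nat) (s : seq bool) : I -> nat :=
  if s is b :: s' then fun j => \sum_i wa_costate A w s' i * A b i j else w.

(** The same matrix product, bracketed from the output side. The machine computes forwards, but
    counting completions from a state recurses on the first letter. *)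
Lemma wa_value_costate (I : finType) A (u w : I -> nat) s :
  wa_value A u w s = \sum_j wa_costate A w s j * u j.
Proof.
rewrite /wa_value; elim: s u => [|b s IH] u //=.
rewrite IH /wa_step.
under eq_bigr do rewrite big_distrr /=.
rewrite exchange_big /=; apply: eq_bigr => j _.
by rewrite big_distrl /=; apply: eq_bigr => i _; rewrite mulnA.
Qed.

Lemma card_tuple_cons n (P : pred (seq bool)) :
  #|[set y : n.+1.-tuple bool | P y]| =
  \sum_(a : bool) #|[set y : n.-tuple bool | P (a :: y)]|.
Proof.
rewrite cardsE -sum1_card big_mkcond /=.
rewrite (reindex (fun z : bool * n.-tuple bool => [tuple of z.1 :: z.2])) /=; last first.
  exists (fun y => (thead y, [tuple of behead y])) => [[a y] _|y _] /=.
    by congr pair; apply: val_inj.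
  by rewrite [RHS]tuple_eta; apply: val_inj.
rewrite -(pair_big predT predT (fun a (y : n.-tuple bool) => if [tuple of a :: y] \in [pred y : n.+1.-tuple bool | P y] then 1 else 0)) /=.
by apply: eq_bigr => a _; rewrite cardsE -sum1_card [RHS]big_mkcond.
Qed.

Lemma psi_cons n b (y : n.-tuple bool) : psi [tuple of b :: y] = b * 2 ^ n + psi y.
Proof.
rewrite /psi big_ord_recl /= subn0 (tnth_nth false) /=; congr addn.
apply: eq_bigr => i _; rewrite !(tnth_nth false) /=; congr (_ * 2 ^ _).
by rewrite /bump /=; lia.
Qed.

Lemma psiE n (y : n.-tuple bool) : psi y = \sum_(k < n) nth false y k * 2 ^ (n.-1 - k).
Proof. by apply: eq_bigr => k _; rewrite (tnth_nth false). Qed.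

Lemma psi_lt n (y : n.-tuple bool) : psi y < 2 ^ n.
Proof. by rewrite psiE binary_lt. Qed.

(** Tails are below [2 ^ n], so the leading bits decide unless they agree. *)
Lemma leq_psi_cons n a b (y c : n.-tuple bool) :
  (psi [tuple of a :: y] <= psi [tuple of b :: c]) =
  ~~ (a && ~~ b) && ((a == b) ==> (psi y <= psi c)).
Proof.
rewrite !psi_cons; have := psi_lt y; have := psi_lt c.
by case: a; case: b => /=; lia.
Qed.

(* The flag of a state records whether the counted word still agrees with the
   input; a word that has become larger than the input gets weight 0. *)
Definition rank_weight (T : finType) (delta : T -> bool -> T) (b : bool) (i j : bool * T) : nat :=
  \sum_(a : bool) (~~ (j.1 && (a && ~~ b)) && (i == (j.1 && (a == b), delta j.2 a))).

(** A costate entry counts the accepted completions from that state: split on the first letter [a]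
    of the counted word, which determines the next flag and state. *)
Lemma rank_costate (T : finType) (delta : T -> bool -> T) (F : pred T) n (c : n.-tuple bool) e q :
  wa_costate (rank_weight delta) (fun i => F i.2) c (e, q) =
  #|[set y : n.-tuple bool | F (foldl delta q y) && (e ==> (psi y <= psi c))]|.
Proof.
elim: n c e q => [|n IH] c e q.
  rewrite (tuple0 c) /=.
  have -> : [set y : 0.-tuple bool | F (foldl delta q y) && (e ==> (psi y <= psi [tuple]))]
          = if F q then setT else set0.
    apply/setP => y; rewrite (tuple0 y) !inE leqnn implybT andbT /=.
    by case: (F q); rewrite inE.
  by case: (F q); rewrite ?cards0 // cardsT card_tuple expn0.
case/tupleP: c => b c /=.
rewrite (eq_bigr (fun i => \sum_(a : bool) if i == (e && (a == b), delta q a)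
    then wa_costate (rank_weight delta) (fun i => F i.2) c i * ~~ (e && (a && ~~ b)) else 0)); last first.
  move=> i _; rewrite /rank_weight big_distrr /=; apply: eq_bigr => a _.
  by case: (i == _); rewrite ?andbT ?andbF ?muln0.
rewrite exchange_big /=.
(* Splitting off the first letter needs a predicate on plain sequences, hence the expanded [psi]. *)
pose P (s : seq bool) := F (foldl delta q s) &&
  (e ==> (\sum_(k < n.+1) nth false s k * 2 ^ (n - k) <= psi [tuple of b :: c])).
transitivity #|[set y : n.+1.-tuple bool | P y]|; last first.
  by apply: eq_card => y; rewrite !inE /P (psiE y).
rewrite card_tuple_cons /P {P}; apply: eq_bigr => a _.
rewrite -big_mkcond big_pred1_eq IH.
have E (y : n.-tuple bool) :
    \sum_(k < n.+1) nth false (a :: y) k * 2 ^ (n - k) = psi [tuple of a :: y] by rewrite psiE.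
(* A word that exceeds the input at this letter has weight 0, and no such word is counted on the
   right. *)
case bad : (e && (a && ~~ b)) => /=.
  rewrite muln0; apply/esym/eqP; rewrite cards_eq0; apply/eqP/setP => y.
  by rewrite !inE E leq_psi_cons /=; case/andP: bad => -> -> /=; rewrite andbF.
rewrite muln1; apply: eq_card => y; rewrite !inE E leq_psi_cons /=; congr andb.
by case: e bad => //= ->.
Qed.

(** * The sliding-window automaton *)

Section WindowAutomaton.
Variables beta p : nat.
Hypothesis beta_gt0 : 0 < beta.

(** [wwl] for sequences of arbitrary length, so that induction over prefixes is possible. *)
Definition ok_windows (s : seq bool) :=
  [forall i : 'I_(size s).+1, (i + beta <= size s) ==>
     (\sum_(i <= k < i + beta) nth false s k <= p)].

Lemma ok_windowsP s : reflect
  (forall i, i + beta <= size s -> \sum_(i <= k < i + beta) nth false s k <= p)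
  (ok_windows s).
Proof.
apply: (iffP forallP) => [H i le_i|H i]; last by apply/implyP/H.
have lt_i : i < (size s).+1 by lia.
exact: (implyP (H (Ordinal lt_i))).
Qed.

Lemma sum_nth_drop (s : seq bool) i m : i + m = size s ->
  \sum_(i <= k < i + m) nth false s k = count id (drop i s).
Proof.
move=> size_s; rewrite -{1}[i]add0n big_addn addKn.
rewrite -sumn_count sumnE big_map (big_nth false) size_drop -size_s addKn.
by apply: eq_bigr => k _; rewrite nth_drop addnC.
Qed.

Definition window_ok (w : seq bool) := (size w < beta) || (count id w <= p).

(** Appending a bit creates at most one new window, the last [beta] bits, which lead the reversed
    word. *)
Lemma ok_windows_rcons s b : ok_windows (rcons s b) =
  ok_windows s && window_ok (take beta (rev (rcons s b))).
Proof.
have inner i : i + beta <= size s ->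
    \sum_(i <= k < i + beta) nth false (rcons s b) k = \sum_(i <= k < i + beta) nth false s k.
  move=> le_i; apply: eq_big_nat => k /andP[_ lt_k].
  by rewrite nth_rcons ifT //; lia.
have last_w : beta <= (size s).+1 ->
    \sum_((size s).+1 - beta <= k < (size s).+1 - beta + beta) nth false (rcons s b) k
    = count id (take beta (rev (rcons s b))).
  move=> le_b; rewrite sum_nth_drop ?size_rcons; last by lia.
  by rewrite take_rev count_rev size_rcons.
rewrite /window_ok size_take size_rev size_rcons.
apply/ok_windowsP/andP => [H|[/ok_windowsP Hs Hb] i].
  split; first by apply/ok_windowsP => i le_i; rewrite -inner // H ?size_rcons //; lia.
  case: (leqP beta (size s).+1) => le_b; last by rewrite ifN ?le_b //; lia.
  by apply/orP; right; rewrite -last_w // H ?size_rcons //; lia.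
rewrite size_rcons => le_i.
have [le_i'|lt_i] := leqP (i + beta) (size s); first by rewrite inner ?Hs.
have -> : i = (size s).+1 - beta by lia.
rewrite last_w; last by lia.
by move: Hb; case: ifP => _ /orP[] //; lia.
Qed.

(** The flag says whether all windows so far were admissible; the bounded sequence keeps the latest
    bits, newest first, and makes the state set finite. *)
Definition wstate : finType := (bool * beta.-bseq bool)%type.

Lemma size_take_leq (s : seq bool) : size (take beta s) <= beta.
Proof. by rewrite size_take_min geq_minl. Qed.

Definition newest (s : seq bool) : beta.-bseq bool := Bseq (size_take_leq s).

Definition wstep (q : wstate) (b : bool) : wstate :=
  let w := newest (b :: q.2) in (q.1 && window_ok w, w).

Definition wstart : wstate := (ok_windows [::], newest [::]).

Lemma foldl_wstep s : foldl wstep wstart s = (ok_windows s, newest (rev s)).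
Proof.
elim/last_ind: s => [|s b IH] //.
(* Bits older than the stored ones cannot enter the new window, so truncating before or after adding
   [b] is the same. *)
have newestE : newest (b :: newest (rev s)) = newest (rev (rcons s b)).
  apply: val_inj; rewrite /= rev_rcons; case: beta beta_gt0 => //= m _.
  by rewrite take_takel.
rewrite foldl_rcons IH ok_windows_rcons /wstep newestE.
by congr (_ && window_ok _, _); rewrite -[RHS]/(newest _ : seq bool) -newestE.
Qed.

End WindowAutomaton.

(** * The order as the value of a weighted automaton, and the conclusion *)

Lemma ord_wa_value beta p n (c : n.-tuple bool) : 0 < beta ->
  ord beta p c = wa_value (rank_weight (@wstep beta p)) (fun i => i == (true, wstart beta p))
                  (fun i => i.2.1) c.
Proof.
move=> beta_gt0; rewrite wa_value_costate.
(* The initial vector is the indicator of the start state with the agreement flag set, so a single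
   costate entry survives. *)
rewrite (eq_bigr (fun j => if j == (true, wstart beta p) then
   wa_costate (rank_weight (@wstep beta p)) (fun i => i.2.1) c j else 0)); last first.
  by move=> j _; case: eqP; rewrite ?muln1 ?muln0.
rewrite -big_mkcond big_pred1_eq (rank_costate (@wstep beta p) (fun q => q.1) c).
apply: eq_card => y; rewrite !inE foldl_wstep //=; congr andb.
by rewrite /wwl /ok_windows size_tuple.
Qed.

(* For fixed beta, p >= 1 there is a RAM program P and a constant K such that
   on every input (n, c) with c in S_n(beta,p), P halts within K(n+1) steps,
   uses only memory cells with address < K(n+1), and leaves ord(c) in M[0]. *)
Theorem theorem9 (beta p : nat) (hbeta : 0 < beta) (hp : 0 < p) :
  exists (P : seq instr) (K : nat),
    forall (n : nat) (c : n.-tuple bool), wwl beta p c ->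
      exists (steps : nat) (mf : memory) (space : nat),
        run P (K * n.+1) 0 (init_mem c) = Some (steps, mf, space) /\
        steps <= K * n.+1 /\
        space <= K * n.+1 /\
        mf 0 = ord beta p c.
Proof.
have [P [K ramP]] := ram_wa_value (rank_weight (@wstep beta p))
  (fun i => i == (true, wstart beta p)) (fun i => i.2.1).
by exists P, K => n c _; rewrite ord_wa_value.
Qed.
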